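(* Let $f : [a,b] \to \mathbb{R}$ be continuous, and define $F : [a,b] \to \mathbb{R}$ by \[ F(x) = \int_a^x f(t)\,dt. \] Then $F$ is differentiable on $[a,b]$ with $\frac{d}{dx}F(x) = f(x)$ for every $x \in [a,b]$.
   Context: The integral is the Riemann integral. The derivative of $F$ at $x \in (a,b)$ is $\frac{d}{dx}F(x) := \lim_{h\to 0} \frac{F(x+h)-F(x)}{h}$ when the limit exists; at the endpoints $a$ and $b$ the corresponding one-sided limits are used. *)

(* Defs.v *)
From Stdlib Require Import Reals.
From Coquelicot Require Import Coquelicot.
Open Scope R_scope.

Definition Icc (a b : R) : R -> Prop := fun x => a <= x <= b.

Definition diff_quotient (F : R -> R) (x h : R) : R := (F (x + h) - F x) / h.

(* [l] is the derivative at [x] of a function on [a, b]: the two-sided limit of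
   the difference quotient at interior points, the one-sided limit at [a] and
   [b]. Since only small [h] of the indicated sign matter, the values of [F]
   outside [a, b] are irrelevant. Meant for [a < b] and [x] in [a, b]; for any
   other [x] all three clauses hold vacuously. *)
Definition is_derivative_Icc (a b : R) (F : R -> R) (x l : R) : Prop :=
  (a < x < b -> filterlim (diff_quotient F x) (locally' 0) (locally l)) /\
  (x = a -> filterlim (diff_quotient F x) (at_right 0) (locally l)) /\
  (x = b -> filterlim (diff_quotient F x) (at_left 0) (locally l)).

(* Main.v *)
(** Composing [f] with the retraction of the line onto [[a, b]] gives a function
    continuous on the whole line that agrees with [f] on [[a, b]]. Its integral
    from [a] is differentiable everywhere by the two-sided fundamental theorem,
    and on [[a, b]] it coincides with the integral of [f]. *)
Require Import Defs.
From Stdlib Require Import Reals Lra.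
From Coquelicot Require Import Coquelicot.
Open Scope R_scope.

Definition clamp (a b x : R) : R := Rmax a (Rmin b x).

Lemma clamp_Icc (a b x : R) : a <= b -> Icc a b (clamp a b x).
Proof.
  intros hab; unfold Icc, clamp, Rmax, Rmin.
  destruct (Rle_dec b x), (Rle_dec a _); lra.
Qed.

Lemma clamp_id (a b x : R) : Icc a b x -> clamp a b x = x.
Proof.
  intros hx; unfold Icc in hx; unfold clamp.
  rewrite Rmin_right, Rmax_right; lra.
Qed.

Lemma clamp_contraction (a b x y : R) :
  Rabs (clamp a b y - clamp a b x) <= Rabs (y - x).
Proof.
  unfold clamp, Rmax, Rmin.
  destruct (Rle_dec b x), (Rle_dec b y);
    repeat destruct (Rle_dec a _); unfold Rabs;
    repeat destruct (Rcase_abs _); lra.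
Qed.

(** [hf] only gives limits along points of [Icc a b]. This suffices because [clamp] takes all its
    values there and is 1-Lipschitz, so the same [eps] serves before and after clamping. *)
Lemma continuous_clamp_extension (a b : R) (f : R -> R) :
  a <= b -> continuous_on (Icc a b) f ->
  forall x, continuous (fun y => f (clamp a b y)) x.
Proof.
  intros hab hf x.
  apply (filterlim_comp _ _ _ (clamp a b) f _
           (within (Icc a b) (locally (clamp a b x)))).
  - intros P [eps hP]. exists eps. intros y hy.
    apply hP; [|now apply clamp_Icc].
    apply Rle_lt_trans with (2 := hy), clamp_contraction.
  - now apply hf, clamp_Icc.
Qed.

Lemma is_derive_diff_quotient (F : R -> R) (x l : R) :
  is_derive F x l -> filterlim (diff_quotient F x) (locally' 0) (locally l).
Proof.
  intros hF%is_derive_Reals P [eps hP].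
  destruct (hF eps (cond_pos eps)) as [d hd].
  exists d; intros h hh h0.
  apply hP, hd; [exact h0|].
  replace h with (h - 0) by ring; exact hh.
Qed.

(** The two-sided limit for [G] restricts to each one-sided filter, and near 0 the admissible [h]
    keep [x + h] in [Icc a b], where the quotients of [F] and [G] agree. *)
Lemma is_derivative_Icc_of_is_derive (a b : R) (F G : R -> R) (x l : R) :
  a < b -> (forall y, Icc a b y -> G y = F y) -> is_derive G x l ->
  is_derivative_Icc a b F x l.
Proof.
  intros hab hFG hG%is_derive_diff_quotient.
  (* All three clauses are instances: [Q h] is [h <> 0], [0 < h] or [h < 0]. *)
  assert (key : forall Q : R -> Prop, Icc a b x -> (forall h, Q h -> h <> 0) ->
    locally 0 (fun h => Q h -> Icc a b (x + h)) ->
    filterlim (diff_quotient F x) (within Q (locally 0)) (locally l)).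
  { intros Q hx hQ hloc.
    apply filterlim_ext_loc with (diff_quotient G x).
    - unfold within; revert hloc; apply filter_imp; intros h hh qh.
      unfold diff_quotient; rewrite !hFG; auto.
    - intros P hP; generalize (hG P hP); unfold filtermap, locally', within.
      apply filter_imp; auto. }
  assert (nbhs : forall d : posreal, locally 0 (fun h => - d < h < d)).
  { intros d; exists d; intros h hh; apply Rabs_def2 in hh.
    unfold minus, plus, opp in hh; simpl in hh; lra. }
  repeat split.
  - intros hx.
    (* The radius is the distance from [x] to the nearer endpoint. *)
    assert (hd : 0 < Rmin (x - a) (b - x)) by (apply Rmin_glb_lt; lra).
    apply key; [unfold Icc; lra | auto |].
    generalize (nbhs (mkposreal _ hd)); apply filter_imp; simpl; intros h hh _.
    generalize (Rmin_l (x - a) (b - x)) (Rmin_r (x - a) (b - x)).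
    unfold Icc; lra.
  - intros ->.
    (* The sign of [h] keeps [a + h] above [a]; the radius [b - a] keeps it below [b]. *)
    assert (hd : 0 < b - a) by lra.
    apply key; [unfold Icc; lra | intros; lra |].
    generalize (nbhs (mkposreal _ hd)); apply filter_imp; simpl; intros h hh h0.
    unfold Icc; lra.
  - intros ->.
    assert (hd : 0 < b - a) by lra.
    apply key; [unfold Icc; lra | intros; lra |].
    generalize (nbhs (mkposreal _ hd)); apply filter_imp; simpl; intros h hh h0.
    unfold Icc; lra.
Qed.

Theorem theorem6p2 (a b : R) (f : R -> R) (hab : a < b)
    (hf : continuous_on (Icc a b) f) :
  (forall x : R, Icc a b x -> ex_RInt f a x) /\
  (forall x : R, Icc a b x ->
     is_derivative_Icc a b (fun y : R => RInt f a y) x (f x)).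
Proof.
  set (g := fun y => f (clamp a b y)).
  assert (hg : forall x, continuous g x)
    by (apply continuous_clamp_extension; [lra | exact hf]).
  assert (ig : forall x, ex_RInt g a x)
    by (intros x; apply (ex_RInt_continuous (V := R_CompleteNormedModule)); auto).
  assert (gf : forall x, Icc a b x ->
    forall t, Rmin a x < t < Rmax a x -> g t = f t).
  { intros x hx t; unfold Icc in hx; rewrite Rmin_left, Rmax_right by lra.
    intros ht; unfold g; rewrite clamp_id; [easy | unfold Icc; lra]. }
  split; intros x hx.
  - apply ex_RInt_ext with g; [exact (gf x hx) | apply ig].
  - apply is_derivative_Icc_of_is_derive with (fun y => RInt g a y); [exact hab | |].
    + intros y hy; apply RInt_ext; exact (gf y hy).
    + replace (f x) with (g x) by (unfold g; now rewrite clamp_id).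
      apply is_derive_RInt with a; [|apply hg].
      (* The integral must exist on a two-sided neighbourhood of [x], which leaves [Icc a b] when
         [x] is an endpoint; [g] is integrable from [a] to any real. *)
      apply filter_forall; intros y; now apply (RInt_correct (V := R_CompleteNormedModule)).
Qed.
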